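(* Let $T$ be the $d$-regular rooted tree and let $G\le\mathrm{Aut}(T)$ be a martingale virtually mixing group with mixing subgroup $H$. If in every coset $S$ of $G/H$ there exists an element $s\in S$ that fixes infinitely many ends of $T$, then $$\mathrm{FPP}(G)=0.$$
   Context: $T$ is the rooted tree whose vertices are the finite words over $\{1,\dots,d\}$, $d\ge 2$ (root: empty word; $v$ adjacent to $vx$). $|v|$ is word length and $\mathcal L_n$ the set of words of length $n$. $\mathrm{Aut}(T)$ is the group of rooted tree automorphisms; $\pi_n$ denotes restriction of the action to the first $n$ levels. An end is an infinite simple path starting at the root. The section $g|_v$ is defined by $g(vw)=g(v)\,g|_v(w)$. For $G\le \mathrm{Aut}(T)$: $\mathrm{st}_G(v)$ is the stabilizer of $v$, $\mathrm{St}_G(n)=\bigcap_{v\in\mathcal L_n}\mathrm{st}_G(v)$, and for $H\le G$, $H_v=\{h|_v: h\in H,\ h(v)=v\}$. $G$ is self-similar if $g|_v\in G$ for all $g\in G$, $v\in T$; fractal if it is self-similar, transitive on every level, and $G_v=G$ for all $v$. $G$ is a martingale group if for all $n\ge1$ and $v\in\mathcal L_n$, $\mathrm{St}_G(n)$ acts transitively on each level of the subtree $T_v=\{vw\}$. A fractal $G$ is virtually mixing if there are $N\ge0$ (a delay constant) and a finite-index subgroup $H\le G$ (a mixing subgroup) with $H\le \mathrm{St}_G(n)_v$ for all $n\ge1$ and all $v$ with $|v|\ge n+N$. The fixed-point proportion of $G$ is $$\mathrm{FPP}(G)=\lim_{n\to\infty}\frac{\#\{g\in\pi_n(G): g\text{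 fixes at least one vertex in }\mathcal L_n\}}{|\pi_n(G)|}$$ (the limit always exists; for closed $G$ it is the Haar probability of the set of elements fixing at least one vertex at every level). *)

(* Defs.v *)
From HB Require Import structures.
From mathcomp Require Import all_boot all_order all_algebra.
From mathcomp Require Import boolp classical_sets functions cardinality reals.
From mathcomp Require Import topology normedtype sequences.

Set Implicit Arguments.
Unset Strict Implicit.
Unset Printing Implicit Defensive.

Import Order.TTheory GRing.Theory Num.Theory.
Import numFieldNormedType.Exports.

Local Open Scope classical_set_scope.

Definition word (d : nat) : Type := seq 'I_d.

Definition tree_adj (d : nat) (u v : word d) : Prop :=
  exists x : 'I_d, v = rcons u x \/ u = rcons v x.

Definition tree_aut (d : nat) (g : word d -> word d) : Prop :=
  [/\ bijective g, g [::] = [::]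
    & forall u v, tree_adj (g u) (g v) <-> tree_adj u v].

(* Meaningful for tree automorphisms only; see [sectionE]. *)
Definition section (d : nat) (g : word d -> word d) (v : word d)
    : word d -> word d :=
  fun w => drop (size v) (g (v ++ w)).

Lemma tree_aut_rcons (d : nat) (g : word d -> word d) : tree_aut g ->
  forall v x, exists y, g (rcons v x) = rcons (g v) y.
Proof.
case=> /bij_inj ginj g0 gadj; elim/last_ind => [|v z IH] x.
  have /gadj [y [->|]] : tree_adj [::] (rcons [::] x) by exists x; left.
    by exists y.
  by rewrite g0 => /(congr1 size); rewrite size_rcons.
have /gadj [y [->|]] : tree_adj (rcons v z) (rcons (rcons v z) x).
- by exists x; left.
- by exists y.
have [t ->] := IH z; move/rcons_inj => -[/ginj /(congr1 size) e _].
by move: e; rewrite !size_rcons => /eqP; rewrite -addn2 -[X in X == _]addn0 eqn_add2l.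
Qed.

Lemma size_tree_aut (d : nat) (g : word d -> word d) : tree_aut g ->
  forall v, size (g v) = size v.
Proof.
move=> ga; elim/last_ind => [|v x IH]; first by case: ga => _ ->.
by have [y ->] := tree_aut_rcons ga v x; rewrite !size_rcons IH.
Qed.

Lemma sectionE (d : nat) (g : word d -> word d) : tree_aut g ->
  forall v w, g (v ++ w) = g v ++ section g v w.
Proof.
move=> ga v w; rewrite /section -(size_tree_aut ga v).
suff [s ->] : exists s, g (v ++ w) = g v ++ s by rewrite drop_size_cat.
elim/last_ind: w => [|w x [s IH]]; first by exists [::]; rewrite !cats0.
rewrite -rcons_cat; have [y ->] := tree_aut_rcons ga (v ++ w) x.
by exists (rcons s y); rewrite IH rcons_cat.
Qed.

Definition aut_subgroup (d : nat) (G : set (word d -> word d)) : Prop :=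
  [/\ G `<=` @tree_aut d,
      G id,
      forall g h, G g -> G h -> G (g \o h)
    & forall g h, G g -> cancel g h -> cancel h g -> G h].

Definition vstab (d : nat) (G : set (word d -> word d)) (v : word d) :
    set (word d -> word d) :=
  [set g | G g /\ g v = v].

Definition lstab (d : nat) (G : set (word d -> word d)) (n : nat) :
    set (word d -> word d) :=
  \bigcap_(v in [set v : word d | size v = n]) vstab G v.

(* The set H_v of the sections at v of the elements of H fixing v. *)
Definition sections (d : nat) (H : set (word d -> word d)) (v : word d) :
    set (word d -> word d) :=
  [set section h v | h in vstab H v].

Definition self_similar (d : nat) (G : set (word d -> word d)) : Prop :=
  forall g v, G g -> G (section g v).

Definition level_transitive (d : nat) (G : set (word d -> word d)) : Prop :=
  forall v w, size v = size w -> exists2 g, G g & g v = w.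

Definition fractal (d : nat) (G : set (word d -> word d)) : Prop :=
  [/\ self_similar G, level_transitive G & forall v, sections G v = G].

Definition martingale_group (d : nat) (G : set (word d -> word d)) : Prop :=
  forall (n : nat) (v : word d), (1 <= n)%N -> size v = n ->
  forall w w' : word d, size w = size w' ->
  exists2 g, lstab G n g & g (v ++ w) = v ++ w'.

Definition left_cosets (d : nat) (G H : set (word d -> word d)) :
    set (set (word d -> word d)) :=
  [set [set g \o h | h in H] | g in G].

Definition mixing_subgroup (d : nat) (G H : set (word d -> word d)) : Prop :=
  [/\ aut_subgroup H, H `<=` G, finite_set (left_cosets G H)
    & exists N : nat, forall (n : nat) (v : word d),
        (1 <= n)%N -> (n + N <= size v)%N -> H `<=` sections (lstab G n) v].

Definition virtually_mixing (d : nat) (G : set (word d -> word d)) : Prop :=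
  fractal G /\ exists H, mixing_subgroup G H.

Definition tree_end (d : nat) (e : nat -> word d) : Prop :=
  [/\ e 0 = [::], injective e & forall n, tree_adj (e n) (e n.+1)].

Definition fixed_ends (d : nat) (g : word d -> word d) :
    set (nat -> word d) :=
  [set e | tree_end e /\ g \o e = e].

(* [insub_bseq n] truncates to length n, which does nothing here when g is a
   tree automorphism, since g then preserves length. *)
Definition restr (d n : nat) (g : word d -> word d) :
    {ffun n.-bseq 'I_d -> n.-bseq 'I_d} :=
  [ffun w : n.-bseq 'I_d => insub_bseq n (g w)].

Definition fixes_level (d n : nat)
    (a : {ffun n.-bseq 'I_d -> n.-bseq 'I_d}) : bool :=
  [exists w : n.-bseq 'I_d, (size w == n) && (a w == w)].

Definition fixed_proportion (R : realType) (d : nat)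
    (G : set (word d -> word d)) (n : nat) : R :=
  (#|[pred a | (a \in @restr d n @` G) && fixes_level a]|%:R
    / #|[pred a | a \in @restr d n @` G]|%:R)%R.

(* Stated as convergence rather than with [lim], whose default value on a divergent
   sequence of reals is also 0. *)
Definition is_FPP (R : realType) (d : nat) (G : set (word d -> word d))
    (p : R) : Prop :=
  fixed_proportion R G @ \oo --> p.

(* Main.v *)
(* Let F_m(g) be the number of words of length m fixed by g, and P the uniform
   measure on the finite group induced by G on the words of length at most n.
   The martingale property makes (F_m) a nonnegative supermartingale for m >= 1,
   so P(sup F_m >= M) <= d / M.

   Fix M. By the hypothesis on cosets and the finiteness of G / H there is a
   length L such that every coset t H contains an element fixing at least M words
   of length L. If g fixes a word of length m, right multiplication by an element
   of St(m) makes it fix a word v of length m + N, and a second one, which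
   multiplies the section at v by a prescribed element of H by virtual mixing, makes
   it fix M words of length m + N + L below v. Hence, conditionally on the
   action on level m, if F_m > 0 then F_(m+N+L) >= M with probability at
   least 1 / C, where C depends neither on m nor on n. Iterating J times,
   P(F_(1 + J(N+L)) > 0) <= (1 - 1/C)^J + d / M. *)

Require Import Defs.
From HB Require Import structures.
From mathcomp Require Import all_boot all_order all_algebra all_fingroup.
From mathcomp Require Import boolp classical_sets functions cardinality reals.
From mathcomp Require Import topology normedtype sequences.
From mathcomp Require Import ring.
(* Imported again so that subsetP, inE, setIP, ... refer to finite sets. *)
From mathcomp Require Import fintype finset.

Set Implicit Arguments.
Unset Strict Implicit.
Unset Printing Implicit Defensive.

Lemma sum_nat_bool_card (I : finType) (A P : pred I) :
  \sum_(i | A i) P i = #|[set i | A i && P i]|.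
Proof.
by rewrite -sum1dep_card big_mkcondr; apply: eq_bigr => i _; case: (P i).
Qed.

(** * Escape of a supermartingale on a finite group *)

Section Escape.
Variables (gT : finGroupType) (Q : {group gT}) (S : nat -> {group gT}).
Variables (F : nat -> gT -> nat) (J C M D : nat).

(** The cosets [S j * g] are the atoms of the information at time [j]: [F_inv] is adaptedness, while
    [F_super] and [F_jump] are conditional statements with denominators cleared. *)
Hypothesis SQ : forall j, j < J -> S j \subset Q.
Hypothesis F_inv : forall i j k g, i <= j < J -> k \in S j -> F i (k * g)%g = F i g.
Hypothesis F_super : forall j g, j < J -> g \in Q ->
  \sum_(k in S j) F j.+1 (k * g)%g <= #|S j| * F j g.
Hypothesis F_jump : forall j g, j < J -> g \in Q -> 0 < F j g ->
  #|S j| <= C * #|[set k in S j | M <= F j.+1 (k * g)%g]|.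
Hypothesis F_absorb : forall j g, j < J -> g \in Q -> F j g = 0 -> F j.+1 g = 0.
Hypothesis F_init : forall g, g \in Q -> F 0 g <= D.

(* Averaging over K replaces conditioning on a coset of K. *)
Lemma sum_translate (K : {group gT}) (E : pred gT) (f : gT -> nat) :
  K \subset Q -> (forall k g, k \in K -> E (k * g)%g = E g) ->
  #|K| * \sum_(g in Q | E g) f g =
  \sum_(g in Q | E g) \sum_(k in K) f (k * g)%g.
Proof.
move=> sKQ invE; rewrite exchange_big /= -sum_nat_const.
apply: eq_bigr => k kK; rewrite (reindex_inj (mulgI k)) /=.
by apply: eq_bigl => g; rewrite (groupMl _ (subsetP sKQ _ kK)) invE.
Qed.

Definition low j g := [forall i : 'I_j.+1, F i g < M].

Lemma lowS j g : low j.+1 g = low j g && (F j.+1 g < M).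
Proof.
apply/forallP/andP => [lo|[/forallP lo loj] i].
  split; last exact: (lo ord_max).
  by apply/forallP => i; apply: (lo (widen_ord (leqnSn _) i)).
case: (ltngtP i j.+1) => [ij||->//]; first exact: (lo (Ordinal ij)).
by rewrite ltnNge -ltnS ltn_ord.
Qed.

Lemma low_inv j k g : j < J -> k \in S j -> low j (k * g)%g = low j g.
Proof.
move=> jJ kS; apply: eq_forallb => i.
by rewrite (F_inv (j := j)) // jJ -ltnS ltn_ord.
Qed.

(** In each coset of [S j] inside the event at time [j], a share of at least 1/C jumps to [M] or
    more and so stops being low. By [F_absorb] the event at time [j.+1] lies in what remains. *)
Lemma escape_step j : j < J ->
  C * #|[set g in Q | low j.+1 g && (0 < F j.+1 g)]| <=
  C.-1 * #|[set g in Q | low j g && (0 < F j g)]|.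
Proof.
move=> jJ; set E := fun g => low j g && (0 < F j g).
have invE k g : k \in S j -> E (k * g)%g = E g.
  by move=> kS; rewrite /E low_inv // (F_inv (j := j)) // leqnn.
set A := [set g in Q | _]; set B := [set g in Q | _].
set B' := [set g in B | M <= F j.+1 g].
have subA : A \subset B :\: B'.
  apply/subsetP => g; rewrite !inE lowS => /andP[gQ /andP[/andP[-> lt] gt]].
  rewrite (leqNgt M) lt gQ /= andbF /=.
  by case: (posnP (F j g)) => // /(F_absorb jJ gQ) e; rewrite e in gt.
have cB : #|B| <= C * #|B'|.
  rewrite -(leq_pmul2l (cardG_gt0 (S j))).
  have -> : #|B'| = \sum_(g in Q | E g) (M <= F j.+1 g).
    rewrite -sum1_card big_mkcondr [RHS]big_mkcond [LHS]big_mkcond /=.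
    apply: eq_bigr => g _; rewrite !inE /E.
    by case: (g \in Q) => //=; case: (low j g && _) => //=; case: (_ <= _).
  rewrite mulnCA sum_translate ?SQ // big_distrr /= mulnC -sum1_card.
  rewrite big_distrl /= (eq_bigl (fun g => (g \in Q) && E g)); last first.
    by move=> g; rewrite !inE.
  apply: leq_sum => g /andP[gQ /andP[_ Fg]]; rewrite mul1n.
  apply: leq_trans (F_jump jJ gQ Fg) _; rewrite leq_mul2l; apply/orP; right.
  rewrite -sum1_card big_mkcond [X in _ <= X]big_mkcond /=.
  by apply: leq_sum => k _; rewrite inE; case: (k \in _) => //=; case: (_ <= _).
have sB : B' \subset B by apply/subsetP => g; rewrite inE => /andP[].
have := subset_leq_card subA; rewrite cardsD (setIidPr sB) => lA.
case: C cB => [|c] cB; first by rewrite mul0n.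
rewrite /= -(leq_add2r (c.+1 * #|B'|)) -mulnDr.
apply: (@leq_trans (c.+1 * #|B|)).
  by rewrite leq_mul2l -(subnK (subset_leq_card sB)) leq_add2r lA orbT.
by rewrite mulSn addnC leq_add2l.
Qed.

Lemma escape_geom j : j <= J ->
  C ^ j * #|[set g in Q | low j g && (0 < F j g)]| <= C.-1 ^ j * #|Q|.
Proof.
elim: j => [_|j IH jJ].
  by rewrite !mul1n subset_leq_card //; apply/subsetP => g; rewrite inE => /andP[].
rewrite expnSr -mulnA; apply: leq_trans (leq_mul (leqnn _) (escape_step jJ)) _.
by rewrite mulnCA expnS -mulnA leq_mul2l IH ?orbT // ltnW.
Qed.

(* Doob's maximal inequality for F stopped when it first reaches M. *)
Lemma maximal_ineq j : j <= J ->
  \sum_(g in Q | low j g) F j g + M * #|[set g in Q | ~~ low j g]| <= D * #|Q|.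
Proof.
elim: j => [_|j IH jJ].
  rewrite -!sum1_card !big_distrr /=.
  rewrite [X in X + _]big_mkcondr [X in _ + X]big_mkcond [X in X + _]big_mkcond.
  rewrite [X in _ <= X]big_mkcond -big_split /=.
  apply: leq_sum => g _; rewrite inE !muln1; case: (boolP (g \in Q)) => //= gQ.
  case: (boolP (low 0 g)) => /= [|/forallPn[i]]; first by rewrite addn0 F_init.
  by rewrite (ord1 i) -leqNgt => /leq_trans; apply; apply: F_init.
apply: leq_trans (IH (ltnW jJ)).
have step : \sum_(g in Q | low j g) F j.+1 g <= \sum_(g in Q | low j g) F j g.
  rewrite -(leq_pmul2l (cardG_gt0 (S j))) sum_translate ?SQ //.
    by rewrite big_distrr leq_sum // => g /andP[gQ _]; apply: F_super.
  by move=> k g kS; apply: low_inv.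
apply: leq_trans (leq_add step (leqnn _)).
rewrite ![_ + M * _]addnC.
rewrite -!sum1_card !big_distrr /= ![\sum_(g in [set _ | _]) _]big_mkcond /=.
rewrite ![\sum_(g in Q | _) _]big_mkcond /= -!big_split /=.
(* An element that first reaches [M] at time [j.+1] has [F j.+1 g] at least [M], which pays for its
   weight [M]. *)
apply: leq_sum => g _; rewrite !inE lowS muln1; case: (g \in Q) => //=.
case: (low j g) => //=; case: ltnP => //=; rewrite ?addn0 ?add0n //.
Qed.

(** The survivors at time [J] either stayed low, a share of at most (1 - 1/C)^J by [escape_geom], or
    reached [M], a share of at most D/M by [maximal_ineq]. *)
Lemma escape :
  M * C ^ J * #|[set g in Q | 0 < F J g]| <=
  (M * C.-1 ^ J + C ^ J * D) * #|Q|.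
Proof.
rewrite mulnDl -!mulnA.
set A := [set g in Q | _].
have -> : #|A| = #|A :&: [set g | low J g]| + #|A :\: [set g | low J g]|.
  by rewrite cardsID.
rewrite mulnDr mulnDr; apply: leq_add.
  rewrite leq_mul2l; apply/orP; right; apply: leq_trans (escape_geom (leqnn J)).
  rewrite leq_mul2l; apply/orP; right; apply: subset_leq_card.
  by apply/subsetP => g; rewrite !inE => /andP[/andP[-> ->] ->].
rewrite mulnCA leq_mul2l; apply/orP; right.
apply: leq_trans (maximal_ineq (leqnn J)); apply: leq_trans (leq_addl _ _).
rewrite leq_mul2l; apply/orP; right; apply: subset_leq_card.
by apply/subsetP => g; rewrite !inE => /andP[-> /andP[->]].
Qed.

End Escape.

(** * The finite group induced on the words of length at most n *)

Lemma tree_aut_take (d : nat) (g : word d -> word d) (m : nat) (w : word d) :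
  tree_aut g -> take m (g w) = g (take m w).
Proof.
move=> ga; case: (leqP m (size w)) => [mw|/ltnW wm].
  rewrite -[in LHS](cat_take_drop m w) sectionE // take_size_cat //.
  by rewrite size_tree_aut // size_takel.
by rewrite !take_oversize // size_tree_aut.
Qed.

(** [lstab] constrains only words of length exactly [n], so a shorter word is padded; this takes a
    letter, whence [0 < d]. *)
Lemma lstab_fix (d : nat) (G : set (word d -> word d)) (n : nat)
    (g : word d -> word d) (w : word d) :
  0 < d -> (G `<=` @tree_aut d)%classic -> lstab G n g -> size w <= n -> g w = w.
Proof.
move=> d0 Gaut gst wn; pose t := w ++ nseq (n - size w) (Ordinal d0).
have [Gg gt] : vstab G t g.
  by apply: gst; rewrite /= /t size_cat size_nseq subnKC.
have := tree_aut_take (size w) t (Gaut _ Gg).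
by rewrite gt /t take_size_cat.
Qed.

Section LevelGroup.
Variables (d n : nat) (G : set (word d -> word d)).
Hypothesis hG : aut_subgroup G.

Let X := (n.-bseq 'I_d).

Let Gaut : (G `<=` @tree_aut d)%classic. Proof. by case: hG. Qed.

(** Permutations replace the finite functions of [restr] to give access to orbits and cosets;
    [pval_restr] identifies the two. *)
Definition level_set : {set {perm X}} :=
  [set p : {perm X} | `[< exists2 g, G g & forall w : X, p w = g w :> word d >]].

Lemma level_set_group : group_set level_set.
Proof.
case: hG => _ G1 GM _; apply/group_setP; split.
  by rewrite inE; apply/asboolP; exists id => // w; rewrite perm1.
move=> p q; rewrite !inE => /asboolP[g Gg pg] /asboolP[h Gh qh].
apply/asboolP; exists (h \o g); first exact: GM.
by move=> w; rewrite permM qh /= pg.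
Qed.
Definition level_group : {group {perm X}} := Group level_set_group.

Lemma level_lift (p : {perm X}) : p \in level_group ->
  exists2 g, G g & forall w : X, p w = g w :> word d.
Proof. by rewrite inE => /asboolP. Qed.

Lemma bseq_insub (s : word d) : size s <= n -> insub_bseq n s = s :> word d.
Proof. by move=> sn; rewrite /insub_bseq insubdK. Qed.

Lemma restrE (g : word d -> word d) (w : X) : G g ->
  restr n g w = g w :> word d.
Proof.
by move=> Gg; rewrite ffunE bseq_insub // size_tree_aut ?size_bseq //; apply: Gaut.
Qed.

Lemma level_restr (g : word d -> word d) : G g ->
  exists2 p, p \in level_group & pval p = restr n g.
Proof.
move=> Gg; have inj : injective (restr n g).
  move=> u v /(congr1 val) /=; rewrite !restrE // => e; apply: val_inj => /=.
  by case: (Gaut Gg) => /bij_inj gi _ _; apply: gi.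
have eq_pval : pval (perm inj) = restr n g.
  by apply/ffunP => w; rewrite pvalE permE.
exists (perm inj) => //; rewrite inE; apply/asboolP; exists g => // w.
by rewrite permE restrE.
Qed.

Lemma level_lower (g : word d -> word d) : G g ->
  exists2 p, p \in level_group & forall w : X, p w = g w :> word d.
Proof.
move=> Gg; have [p pQ e] := level_restr Gg; exists p => // w.
by rewrite -restrE // -e pvalE.
Qed.

Lemma size_level (p : {perm X}) (w : X) : p \in level_group ->
  size (p w) = size w.
Proof. by move=> /level_lift[g /Gaut ga ->]; rewrite size_tree_aut. Qed.

Definition trunc (m : nat) (w : X) : X := insub_bseq n (take m w).

Lemma truncE m (w : X) : trunc m w = take m w :> word d.
Proof. by rewrite bseq_insub // size_take_min (leq_trans (geq_minr _ _)) ?size_bseq. Qed.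

Lemma level_trunc m (p : {perm X}) (w : X) : p \in level_group ->
  p (trunc m w) = trunc m (p w).
Proof.
move=> /level_lift[g /Gaut ga pg]; apply: val_inj => /=.
by rewrite pg !truncE pg tree_aut_take.
Qed.

Definition level_fix (m : nat) (p : {perm X}) : nat :=
  #|[set w : X | (size w == m) && (p w == w)]|.

Definition level_stab (m : nat) : {group {perm X}} :=
  'C_level_group([set w : X | size w <= m] | 'P)%G.

Lemma level_stabP (m : nat) (k : {perm X}) :
  reflect (k \in level_group /\ forall w : X, size w <= m -> k w = w)
    (k \in level_stab m).
Proof.
apply: (iffP setIP) => [[-> /astabP kfix]|[-> kfix]]; split=> //.
  by move=> w wm; apply: kfix; rewrite inE.
by apply/astabP => w; rewrite inE => /kfix.
Qed.

(** Prefixes of fixed words are fixed. *)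
Lemma level_fix_absorb m m' p : m <= m' -> p \in level_group ->
  level_fix m p = 0 -> level_fix m' p = 0.
Proof.
rewrite /level_fix => mm' pQ /eqP; rewrite cards_eq0 => /eqP e; apply/eqP; rewrite cards_eq0.
apply/eqP/setP => w; rewrite !inE; apply/negbTE/negP => /andP[/eqP sw /eqP pw].
have := in_set0 (trunc m w); rewrite -e inE level_trunc // pw eqxx andbT.
by rewrite truncE size_takel ?eqxx // sw.
Qed.

Lemma level_fix_stab i m k p : i <= m -> k \in level_stab m ->
  level_fix i (k * p)%g = level_fix i p.
Proof.
move=> im /level_stabP[_ kfix]; apply: eq_card => w; rewrite !inE.
by case: eqP => //= wi; rewrite permM kfix // wi.
Qed.

Hypothesis d0 : 0 < d.
Hypothesis hmart : martingale_group G.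

Lemma lstab_level (m : nat) (g : word d -> word d) : lstab G m g ->
  exists2 k, k \in level_stab m & forall w : X, k w = g w :> word d.
Proof.
move=> gst; have [Gg _] : vstab G (nseq m (Ordinal d0)) g.
  by apply: gst; rewrite /= size_nseq.
have [k kQ kg] := level_lower Gg; exists k => //.
by apply/level_stabP; split=> // w wm; apply: val_inj; rewrite /= kg (lstab_fix d0 Gaut gst).
Qed.

(** Both words hang below one prefix of length [m], where the martingale property moves one tail to
    the other. *)
Lemma level_orbit (m : nat) (w w' : X) : 0 < m -> m <= size w ->
  size w = size w' -> trunc m w = trunc m w' -> w' \in orbit 'P (level_stab m) w.
Proof.
move=> m0 mw sw /(congr1 val) /=; rewrite !truncE => e.
have sd : size (drop m w) = size (drop m w') by rewrite !size_drop sw.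
have [g gst gw] := hmart m0 (size_takel mw) sd.
have [k kS kg] := lstab_level gst; apply/orbitP; exists k => //.
by apply: val_inj; rewrite /= kg -(cat_take_drop m w) gw e cat_take_drop.
Qed.

(* Orbit-stabilizer: the words of length m' below a word of length m fixed by p
   form one orbit of the level stabilizer, so their expected number of fixed
   points under a random k * p is at most 1. *)
Lemma level_fix_super m m' p : 0 < m -> m <= m' -> p \in level_group ->
  \sum_(k in level_stab m) level_fix m' (k * p)%g <= #|level_stab m| * level_fix m p.
Proof.
move=> m0 mm' pQ; set S := level_stab m.
have fixE i (q : {perm X}) : level_fix i q = \sum_(w : X | size w == i) (q w == w).
  exact/esym/sum_nat_bool_card.
rewrite (eq_bigr _ (fun k _ => fixE m' (k * p)%g)) fixE exchange_big /=.
rewrite (partition_big (trunc m) (fun u : X => size u == m)) /=; last first.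
  by move=> w /eqP sw; rewrite truncE size_takel ?sw.
rewrite big_distrr /=; apply: leq_sum => u /eqP su.
(* If [p] moves [u], so does [k * p], because [k] fixes [u]; then no word below [u] is fixed. *)
case: (p u =P u) => [pu|pu]; last first.
  rewrite muln0 big1 // => w /andP[/eqP sw /eqP uw]; rewrite big1 // => k.
  case/level_stabP => kQ kfix; rewrite permM; case: eqP => // pkw; case: pu.
  by rewrite -[in RHS]uw -pkw -!level_trunc // uw kfix ?su.
set O := [set w : X | (size w == m') && (trunc m w == u)].
rewrite muln1 (eq_bigl [in O]); last by move=> w; rewrite /= inE.
have [->|O0] := eqVneq O set0; first by rewrite big_set0.
rewrite -(leq_pmul2l (_ : 0 < #|O|)) ?card_gt0 // big_distrr /= -sum_nat_const.
apply: leq_sum => w; rewrite inE => /andP[/eqP sw /eqP uw].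
rewrite -(card_orbit_stab 'P S w); apply: leq_mul.
  apply: subset_leq_card; apply/subsetP => w'.
  rewrite inE => /andP[/eqP sw' /eqP uw'].
  by apply: level_orbit; rewrite ?sw ?uw ?sw' ?uw'.
rewrite (sum_nat_bool_card [in S]).
(* The [k] for which [k * p] fixes [w] all send [w] to the same word, so they lie in one right coset
   of the stabilizer of [w]. *)
have [->|[k1]] := set_0Vmem [set k in S | (k * p)%g w == w]; first by rewrite cards0.
rewrite inE => /andP[k1S /eqP k1w].
rewrite -(card_rcoset 'C_S[w | 'P]%g k1); apply: subset_leq_card; apply/subsetP => k.
rewrite inE => /andP[kS /eqP kw]; rewrite mem_rcoset.
apply/setIP; split; first by rewrite groupM ?groupV.
apply/astab1P; rewrite /= apermE permM.
by move: kw; rewrite -{2}k1w !permM => /perm_inj ->; rewrite permK.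
Qed.

(* The translates k of k0 that agree with it on the words v ++ y with
   size y <= L all do the same job; an element of the stabilizer acts on these
   words by one of #|{ffun ...}| maps, a bound that is independent of m and n. *)
Lemma level_fix_jump (m N L M : nat) (p k0 : {perm X}) (v : word d) :
  m + N + L <= n -> p \in level_group -> k0 \in level_stab m -> size v = m + N ->
  M <= #|[set w : X | [&& size w == m + N + L, take (m + N) w == v
                       & p (k0 w) == w]]| ->
  #|level_stab m| <= #|{ffun L.-bseq 'I_d -> (N + L).-bseq 'I_d}| *
    #|[set k in level_stab m | M <= level_fix (m + N + L) (k * p)%g]|.
Proof.
move=> mn pQ k0S sv hM; set S := level_stab m; set A := [set k in S | _].
pose Y (y : L.-bseq 'I_d) : X := insub_bseq n (v ++ y).
have YE y : Y y = v ++ y :> word d.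
  rewrite bseq_insub // size_cat sv; apply: leq_trans mn.
  by rewrite leq_add2l size_bseq.
(* The first [m] letters are dropped because [k] fixes [take m v]; this makes the codomain
   independent of [m]. *)
pose Phi (k : {perm X}) : {ffun L.-bseq 'I_d -> (N + L).-bseq 'I_d} :=
  [ffun y => insub_bseq (N + L) (drop m (k (Y y)))].
have PhiE k y : k \in S -> k (Y y) = take m v ++ Phi k y :> word d.
  case/level_stabP => kQ kfix.
  have sk : size (k (Y y)) = m + (N + size y).
    by rewrite size_level // YE size_cat sv addnA.
  rewrite ffunE [X in _ = _ ++ X](_ : _ = drop m (k (Y y))); last first.
    rewrite /insub_bseq insubdK // -topredE /= size_drop sk addKn.
    by rewrite leq_add2l size_bseq.
  rewrite -{1}(cat_take_drop m (k (Y y))); congr (_ ++ _).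
  have := level_trunc m (Y y) kQ; rewrite kfix; last first.
    by rewrite truncE size_take_min geq_minl.
  move/(congr1 val); rewrite /= !truncE YE => <-.
  by rewrite takel_cat // sv leq_addr.
rewrite -sum1_card (partition_big Phi predT) //= -sum_nat_const.
apply: leq_sum => f _; rewrite sum1dep_card.
have [->|[k1]] := set_0Vmem [set k | (k \in S) && (Phi k == f)].
  by rewrite cards0.
rewrite inE => /andP[k1S /eqP k1f].
(* On the words [v ++ y], [k] and [k1] agree, so [k * k1^-1] is the identity there and [tr k] acts
   as [k0]. *)
pose tr (k : {perm X}) := (k * k1^-1 * k0)%g.
have tr_inj : injective tr by move=> k k' /mulIg /mulIg.
rewrite -(card_imset _ tr_inj); apply: subset_leq_card.
apply/subsetP => _ /imsetP[k + ->]; rewrite inE => /andP[kS /eqP kf].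
rewrite in_set !groupM ?groupV //=; apply: leq_trans hM _; apply: subset_leq_card.
apply/subsetP => w; rewrite !inE => /and3P[/eqP sw /eqP wv /eqP pw].
have sdw : size (drop (m + N) w) <= L by rewrite size_drop sw addKn.
have wY : w = Y (Bseq sdw) by apply: val_inj; rewrite /= YE -wv cat_take_drop.
have kw : k w = k1 w by apply: val_inj; rewrite /= wY !PhiE // kf k1f.
by rewrite sw eqxx /= !permM kw permK pw.
Qed.
(** The witness is [g1 \o g2], with both factors in St(m): [g1] makes [g \o g1] fix a word [v] below
    a fixed word of [p], and [g2] fixes [v] with a section in [H] chosen to create the [M] fixed
    words. *)
Lemma level_jump_witness (H : set (word d -> word d)) (m N L M : nat)
    (p : {perm X}) :
  self_similar G ->
  (forall v, m + N <= size v -> (H `<=` sections (lstab G m) v)%classic) ->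
  (forall t, G t -> exists2 h, H h & exists ws : seq (word d),
     [/\ uniq ws, size ws = M & forall w, w \in ws -> size w = L /\ t (h w) = w]) ->
  0 < m -> m + N + L <= n -> p \in level_group -> 0 < level_fix m p ->
  exists2 k0, k0 \in level_stab m & exists2 v : word d, size v = m + N &
  M <= #|[set w : X | [&& size w == m + N + L, take (m + N) w == v
                       & p (k0 w) == w]]|.
Proof.
move=> Gss Hmix Hfix m0 mn pQ /card_gt0P[w0].
rewrite inE => /andP[/eqP sw0 /eqP pw0].
have [g Gg pg] := level_lift pQ; case: hG => _ _ GM GV.
have gw0 : g w0 = w0 by rewrite -pg pw0.
have [gi gK giK] : bijective g by case: (Gaut Gg).
have Ggi : G gi by exact: GV gK giK.
pose v : word d := w0 ++ nseq N (Ordinal d0).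
have sv : size v = m + N by rewrite size_cat size_nseq sw0.
have giv : gi v = w0 ++ drop m (gi v).
  rewrite -{1}(cat_take_drop m (gi v)) tree_aut_take; last exact: Gaut.
  by rewrite /v take_size_cat // -{1}gw0 gK.
have sN : size (nseq N (Ordinal d0)) = size (drop m (gi v)).
  by rewrite size_nseq size_drop size_tree_aut ?sv ?addKn //; apply: Gaut.
(* As [g] fixes [w0], the preimage [gi v] also lies below [w0], so [g1] can send [v] to it. *)
have [g1 g1st g1v] := hmart m0 sw0 sN.
have lstabG k : lstab G m k -> G k.
  by move=> /(_ (nseq m (Ordinal d0)))[]; rewrite //= size_nseq.
have gg1v : g (g1 v) = v by rewrite g1v -giv giK.
have Ggg1 : G (g \o g1) by apply: GM => //; apply: lstabG.
(* By self-similarity the section of [g \o g1] at [v] lies in [G], so its coset of [H] can be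
   used. *)
have [h Hh [ws [ws_uniq sws wsP]]] := Hfix _ (Gss _ v Ggg1).
have [|g2 [g2st g2v] hE] := Hmix v _ _ Hh; first by rewrite sv.
have [k0 k0S k0E] : exists2 k, k \in level_stab m
    & forall w : X, k w = (g1 \o g2) w :> word d.
  apply: lstab_level => w sw /=; split; first by apply: GM; apply: lstabG.
  by have [_ /= ->] := g2st w sw; have [_ ->] := g1st w sw.
exists k0 => //; exists v => //.
pose W w : X := insub_bseq n (v ++ w).
have WE w : w \in ws -> W w = v ++ w :> word d.
  by move=> /wsP[sw _]; rewrite bseq_insub // size_cat sv sw.
have W_uniq : uniq (map W ws).
  rewrite map_inj_in_uniq // => w w' wws w'ws /(congr1 val) /=.
  by rewrite !WE // => /(congr1 (drop (size v))); rewrite !drop_size_cat.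
rewrite -sws -(size_map W) -(card_uniqP W_uniq); apply: subset_leq_card.
apply/subsetP => _ /mapP[w wws ->]; have [sw thw] := wsP w wws.
rewrite inE WE // size_cat sv sw eqxx take_size_cat // eqxx /=.
apply/eqP/val_inj; rewrite /= pg k0E WE //= sectionE; last exact/Gaut/lstabG.
rewrite g2v hE -[g (g1 _)]/((g \o g1) _) sectionE; last exact: Gaut.
by rewrite /= gg1v thw.
Qed.

Lemma pval_restr a : (exists2 p, p \in level_group & pval p = a) <->
  (restr n @` G)%classic a.
Proof.
split=> [[p /level_lift[g Gg pg] <-]|[g Gg <-]]; last first.
  by have [p pQ <-] := level_restr Gg; exists p.
exists g => //; apply/ffunP => w; apply: val_inj; rewrite /= restrE // -pg.
by rewrite pvalE.
Qed.

End LevelGroup.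

(** * From fixed ends to fixed words *)

Local Open Scope classical_set_scope.
(** A step towards the root would return to the previous vertex, against injectivity. *)
Lemma tree_end_rcons (d : nat) (e : nat -> word d) (n : nat) :
  tree_end e -> exists x, e n.+1 = rcons (e n) x.
Proof.
case=> e0 e_inj e_adj; elim: n => [|n [x IH]].
  case: (e_adj 0) => x [->|]; first by exists x.
  by rewrite e0 => /(congr1 size); rewrite size_rcons.
case: (e_adj n.+1) => y [->|]; first by exists y.
by rewrite IH => /rcons_inj[/e_inj /eqP]; rewrite ltn_eqF.
Qed.

Lemma size_tree_end (d : nat) (e : nat -> word d) (n : nat) :
  tree_end e -> size (e n) = n.
Proof.
move=> ee; elim: n => [|n IH]; first by case: ee => ->.
by have [x ->] := tree_end_rcons n ee; rewrite size_rcons IH.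
Qed.

Lemma take_tree_end (d : nat) (e : nat -> word d) (m n : nat) :
  tree_end e -> m <= n -> take m (e n) = e m.
Proof.
move=> ee; elim: n => [|n IH]; first by rewrite leqn0 => /eqP ->; rewrite take_oversize ?size_tree_end.
rewrite leq_eqVlt => /orP[/eqP ->|mn]; first by rewrite take_oversize ?size_tree_end.
have [x ->] := tree_end_rcons n ee.
by rewrite -cats1 takel_cat ?IH // size_tree_end.
Qed.

Lemma infinite_set_injection (T : Type) (A : set T) : infinite_set A ->
  exists2 f : nat -> T, injective f & forall i, A (f i).
Proof.
move=> /infiniteP/card_leP/unsquash f.
exists (fun i => set_val (f (SigSub (mem_set (I : [set: nat] i))))) => [i j|i].
  by move=> /val_inj fij; case: (@inj _ _ _ f _ _ (mem_set I) (mem_set I) fij).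
exact: set_valP.
Qed.

(** Distinct ends separate at some level and remain separate below it; [L0] bounds the separation
    levels of the pairs among [M] chosen ends. *)
Lemma infinite_fixed_ends_words (d : nat) (g : word d -> word d) (M : nat) :
  infinite_set (fixed_ends g) -> exists L0, forall L, L0 <= L ->
  exists ws : seq (word d), [/\ uniq ws, size ws = M
    & forall w, w \in ws -> size w = L /\ g w = w].
Proof.
move=> /infinite_set_injection[f f_inj f_fixed].
have f_end i : tree_end (f i) by have [] := f_fixed i.
have f_fix i L : g (f i L) = f i L.
  by have [_ gf] := f_fixed i; rewrite -[in RHS]gf.
have /choice[sep sepP] : forall ij : nat * nat, exists k, ij.1 != ij.2 ->
    forall L, k <= L -> f ij.1 L <> f ij.2 L.
  case=> i j /=; have [->|ij] := eqVneq i j; first by exists 0.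
  have [k fk] : exists k, f i k <> f j k.
    apply/existsNP => fij; move: ij => /negP; apply; apply/eqP.
    exact/f_inj/funext.
  exists k => _ L kL fL; apply: fk.
  by rewrite -(take_tree_end (f_end i) kL) fL take_tree_end.
exists (\max_(i < M) \max_(j < M) sep (val i, val j)) => L hL.
exists (mkseq (fun i => f i L) M); rewrite size_mkseq; split=> //; last first.
  by move=> _ /mapP[i _ ->]; rewrite size_tree_end.
rewrite map_inj_in_uniq ?iota_uniq // => i j; rewrite !mem_iota /= !add0n => iM jM.
case: (eqVneq i j) => // ij fij; case: (sepP (i, j) ij L) => //.
apply: leq_trans hL; apply: leq_trans (leq_bigmax (Ordinal iM)).
exact: leq_trans (leq_bigmax (Ordinal jM)).
Qed.

(** Each coset allows every sufficiently large length, so the maximum over the finitely many cosets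
    serves them all. *)
Lemma cosets_fixed_words (d : nat) (G H : set (word d -> word d)) (M : nat) :
  finite_set (left_cosets G H) ->
  (forall S, left_cosets G H S -> exists2 s, S s & infinite_set (fixed_ends s)) ->
  exists L, forall t, G t -> exists2 h, H h & exists ws : seq (word d),
    [/\ uniq ws, size ws = M & forall w, w \in ws -> size w = L /\ t (h w) = w].
Proof.
move=> /finite_seqP[cs csE] hcosets.
have /choice[Lf LfP] : forall S, exists L0, left_cosets G H S ->
    exists2 s, S s & forall L, L0 <= L -> exists ws : seq (word d),
    [/\ uniq ws, size ws = M & forall w, w \in ws -> size w = L /\ s w = w].
  move=> S; have [/hcosets[s Ss]|nS] := pselect (left_cosets G H S); last by exists 0.
  by move=> /(infinite_fixed_ends_words M)[L0 hL0]; exists L0 => _; exists s.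
exists (\max_(S <- cs) Lf S) => t Gt.
have St : left_cosets G H [set t \o h | h in H] by exists t.
have [_ [h Hh <-] hL] := LfP _ St; exists h => //.
by apply: hL; apply: leq_bigmax_seq => //; move: St; rewrite csE.
Qed.

(** * Decay of the proportion and passage to the limit *)

Lemma level_fix_decay (d n : nat) (G H : set (word d -> word d))
    (hG : aut_subgroup G) (N L M J C : nat) :
  0 < d -> martingale_group G -> self_similar G ->
  (forall n v, 1 <= n -> n + N <= size v -> H `<=` sections (lstab G n) v) ->
  (forall t, G t -> exists2 h, H h & exists ws : seq (word d),
     [/\ uniq ws, size ws = M & forall w, w \in ws -> size w = L /\ t (h w) = w]) ->
  (J * (N + L)).+1 <= n ->
  C = #|{ffun L.-bseq 'I_d -> (N + L).-bseq 'I_d}| ->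
  M * C ^ J * #|[set p in level_group n hG | 0 < level_fix (J * (N + L)).+1 p]|
  <= (M * C.-1 ^ J + C ^ J * d) * #|level_group n hG|.
Proof.
move=> d0 hmart Gss Hmix Hfix hn ->.
(* The levels start at 1 because the martingale and mixing conditions concern only n >= 1. *)
pose lev j := (j * (N + L)).+1.
have levS j : lev j.+1 = lev j + N + L by rewrite /lev mulSnr -addnA addSn.
have lev_n j : j < J -> lev j + N + L <= n.
  by move=> jJ; rewrite -levS (leq_trans _ hn) // ltnS leq_mul2r jJ orbT.
apply: (@escape _ (level_group n hG) (fun j => level_stab n hG (lev j))
  (fun j => @level_fix d n (lev j)) J _ M d).
- by move=> j _; apply/subsetP => k /level_stabP[].
- move=> i j k p /andP[ij _]; apply: level_fix_stab.
  by rewrite ltnS leq_mul2r ij orbT.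
- move=> j p _ pQ; apply: level_fix_super => //.
  by rewrite levS -addnA leq_addr.
- move=> j p jJ pQ p0.
  have [|k0 k0S [v sv hM]] := level_jump_witness d0 hmart Gss _ Hfix (ltn0Sn _) (lev_n j jJ) pQ p0.
    by move=> v; apply: Hmix.
  by rewrite levS; apply: (level_fix_jump (k0 := k0) (v := v)) => //; apply: lev_n.
- move=> j p jJ pQ.
  apply: (level_fix_absorb (hG := hG)) => //.
  by rewrite levS -addnA leq_addr.
(* The initial level is 1, which has [d] words. *)
move=> p _; rewrite /level_fix.
pose f (x : 'I_d) : n.-bseq 'I_d := insub_bseq n [:: x].
rewrite -[X in _ <= X]card_ord; apply: leq_trans (leq_imset_card f predT).
apply/subset_leq_card/subsetP => w; rewrite inE => /andP[/eqP sw _].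
case: w sw => -[|x [|y s]] // hs _; apply/imsetP; exists x => //.
by apply: val_inj; rewrite /= bseq_insub.
Qed.
Import Order.TTheory GRing.Theory Num.Theory.
Import numFieldNormedType.Exports.

Lemma fixed_proportion_le (R : realType) (d n m : nat)
    (G : set (word d -> word d)) (hG : aut_subgroup G) : m <= n ->
  (fixed_proportion R G n <=
   #|[set p in level_group n hG | (0 < level_fix m p)%N]|%:R / #|level_group n hG|%:R)%R.
Proof.
move=> mn; rewrite /fixed_proportion.
have pval_inj : injective (@pval (n.-bseq 'I_d)) by exact: val_inj.
have mem_restr a : (a \in restr n @` G) = (a \in (@pval _ @: level_group n hG)%SET).
  apply/idP/imsetP => [|[p pQ ->]].
    by rewrite in_setE => /(pval_restr hG)[p pQ <-]; exists p.
  by rewrite in_setE; apply/(pval_restr hG); exists p.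
rewrite (_ : #|[pred a | a \in restr n @` G]| = #|level_group n hG|); last first.
  rewrite -(card_imset _ pval_inj); apply: eq_card => a.
  by rewrite [LHS]inE mem_restr.
apply: ler_wpM2r; rewrite ?invr_ge0 ?ler0n // ler_nat.
rewrite -(card_imset _ pval_inj); apply/subset_leq_card/subsetP => a.
rewrite [_ \in _]inE mem_restr => /andP[/imsetP[p pQ ->]].
case/existsP => w /andP[sw /eqP pw]; apply: imset_f.
rewrite inE pQ lt0n; apply/eqP => /(level_fix_absorb mn pQ) /eqP.
rewrite cards_eq0 => /eqP e; have := in_set0 w.
by rewrite -e inE sw -pvalE pw eqxx.
Qed.

Local Open Scope ring_scope.

Theorem theorem6 (R : realType) (d : nat) (hd : (2 <= d)%N)
    (G H : set (word d -> word d))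
    (hG : aut_subgroup G)
    (hmart : martingale_group G)
    (hmix : virtually_mixing G)
    (hH : mixing_subgroup G H)
    (hcosets : forall S, left_cosets G H S ->
       exists2 s, S s & infinite_set (fixed_ends s)) :
  is_FPP G (0 : R).
Proof.
have d0 : (0 < d)%N by apply: ltn_trans hd.
case: hmix => -[Gss _ _] _; case: hH => _ _ fin_cosets [N Hmix].
apply/cvgr0Pnorm_lt => e e0.
have e2 : 0 < e / 2 by rewrite divr_gt0.
(* Half of [e] is kept for d/M and half for (1 - 1/C)^J. [M] is fixed first, since [L] depends on
   it, [C] on [L], and [J] on [C]. *)
pose M := (Num.truncn (d%:R / (e / 2))).+1.
have dM : d%:R / M%:R < e / 2.
  rewrite ltr_pdivrMr ?ltr0n // mulrC -ltr_pdivrMr //.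
  exact: truncnS_gt.
have [L hL] := cosets_fixed_words M fin_cosets hcosets.
pose C := #|{ffun L.-bseq 'I_d -> (N + L).-bseq 'I_d}|.
have C0 : (0 < C)%N by apply/card_gt0P; exists [ffun=> [bseq]].
pose q : R := C.-1%:R / C%:R.
have q_ge0 : 0 <= q by rewrite divr_ge0.
have q_lt1 : q < 1 by rewrite ltr_pdivrMr ?ltr0n // mul1r ltr_nat prednK.
have [J qJ] : exists J, q ^+ J < e / 2.
  have /cvg_expr/cvgr0Pnorm_lt/(_ _ e2)[J _ hJ] : `|q| < 1 by rewrite ger0_norm.
  by exists J; have := hJ J (leqnn J); rewrite ger0_norm // exprn_ge0.
exists (J * (N + L)).+1 => // n /= hn.
rewrite ger0_norm; last by rewrite divr_ge0.
apply: le_lt_trans (fixed_proportion_le R hG hn) _.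
have Q0 : (0 : R) < #|level_group n hG|%:R by rewrite ltr0n cardG_gt0.
rewrite ltr_pdivrMr //.
have CJ0 : (0 : R) < M%:R * C%:R ^+ J by rewrite mulr_gt0 ?exprn_gt0 ?ltr0n.
rewrite -(ltr_pM2l CJ0).
have := level_fix_decay hG d0 hmart Gss Hmix hL hn (erefl C).
rewrite -(ler_nat R) !natrM natrD !natrM !natrX => /le_lt_trans; apply.
rewrite mulrA ltr_pM2r //.
have -> : M%:R * C.-1%:R ^+ J + C%:R ^+ J * d%:R =
    M%:R * C%:R ^+ J * (q ^+ J + d%:R / M%:R) :> R.
  by rewrite /q expr_div_n; field; rewrite pnatr_eq0 expf_neq0 ?pnatr_eq0 -?lt0n.
by rewrite ltr_pM2l // [ltRHS]splitr ltrD.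
Qed.
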